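(* Let $n\in\mathbb{N}$ and let $\chi,\psi\in\mathrm{Irr}(S_n)$. If $\mathrm{Van}_{\mathrm{pow}}(\chi)\subseteq\mathrm{Van}_{\mathrm{pow}}(\psi)$, then $\chi(1)\le\psi(1)$. In particular, if $\mathrm{Van}_{\mathrm{pow}}(\chi)=\mathrm{Van}_{\mathrm{pow}}(\psi)$, then $\chi(1)=\psi(1)$.
   Context: $\mathrm{Irr}(G)$ denotes the set of irreducible complex characters of a finite group $G$. For a character $\chi$ of $G$, $\mathrm{Van}(\chi)=\{g\in G\mid\chi(g)=0\}$ and $\mathrm{Van}_{\mathrm{pow}}(\chi)=\{g\in\mathrm{Van}(\chi)\mid g\text{ has prime power order}\}$ (order a power of some prime, the prime being allowed to vary with $g$). *)

(* Defs.v *)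
From mathcomp Require Import all_boot all_order all_fingroup all_algebra.
From mathcomp Require Import all_solvable all_field all_character.

Set Implicit Arguments.
Unset Strict Implicit.
Unset Printing Implicit Defensive.

Import GroupScope Order.TTheory GRing.Theory Num.Theory.
Local Open Scope ring_scope.

(* Class functions in 'CF(G) are total on gT and vanish outside G, hence the
   explicit restriction to G. *)
Definition Van (gT : finGroupType) (G : {group gT}) (chi : 'CF(G)) : {set gT} :=
  [set g in G | chi g == 0].

(* p_group A means that A is a p-group for some prime p, and #[g] is by
   definition #|<[g]>|; see Van_powP for the unfolded form. *)
Definition Van_pow (gT : finGroupType) (G : {group gT}) (chi : 'CF(G)) :
  {set gT} := [set g in Van chi | p_group <[g]>].

Lemma Van_powP (gT : finGroupType) (G : {group gT}) (chi : 'CF(G)) (g : gT) :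
  reflect [/\ g \in G, chi g = 0
            & exists p k : nat, prime p /\ #[g]%g = (p ^ k)%N]
          (g \in Van_pow chi).
Proof.
rewrite !inE; apply: (iffP andP) => [[/andP[Gg /eqP chig0] pg]|].
  split=> //; have [p p_pr pgg] := p_groupP pg.
  by exists p; have [k ok] := p_natP pgg; exists k.
case=> Gg -> [p [k [p_pr ok]]]; rewrite Gg eqxx; split=> //.
apply: (@pgroup_p _ p); rewrite /pgroup -orderE ok.
by rewrite pnatX pnat_id.
Qed.

(* Main.v *)
Require Import Defs.
From mathcomp Require Import all_boot all_order all_fingroup all_algebra.
From mathcomp Require Import all_solvable all_field all_character.
From HB Require Import structures.
From mathcomp Require Import mpoly.
From mathcomp Require Import zify.

(** Irreducible characters of the symmetric group are described here by
    Frobenius's formula. A partition is encoded by a beta-set, a tuple [b] of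
    distinct natural numbers, and [frob b s] is the coefficient of the monomial
    [x^b] in [a_delta * p_s], where [a_delta] is the Vandermonde product and [p_s]
    the product of the power sums [p_q], one for each cycle of [s] of length [q].
    Multiplying by [p_q] lowers one entry of [b] by [q] in all possible ways, that
    is, removes a hook of length [q]; this is the Murnaghan-Nakayama rule, whose
    signs are accounted for by the order of the entries of the tuple.

    Each function [frob b] is an integral combination of permutation characters
    on words, it has norm 1 by Cauchy's identity, and no irreducible character is
    orthogonal to all of them because [a_delta] is not a zero divisor. Hence every
    irreducible character is some [frob b] up to sign ([irr_frobchar]).

    Now fix a prime [p]. The weight of [b] for [q] is the number of hooks of length
    [q] that can be removed in succession. By Frobenius's degree formula,
    the [p]-adic valuation of the degree of [frob b] is that of [n!] minus the sum
    of the weights for all [p ^ k], [k > 0] ([logn_degree]). The degree is thus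
    controlled by the weights, and these are visible on [p]-elements. From the
    beta-set [b] of [psi], remove as many hooks as possible of length [p ^ K], then
    of length [p ^ K.-1], and so on ([peel_prime_powers]), and let [x] be a
    permutation whose cycles have the lengths of these hooks. All ways of removing
    a maximal number of hooks of the same length carry the same sign
    ([mcoeff_mul_psum_core]), so [psi x] is nonzero; by hypothesis neither does
    [chi] vanish at [x]. So hooks of the same lengths can be removed from the
    beta-set of [chi], and its weights are at least those of [psi]
    ([weight_lower_bound]). The [p]-part of [chi 1] therefore divides that of
    [psi 1], for every [p], and [chi 1] divides [psi 1]. *)

Set Implicit Arguments.
Unset Strict Implicit.
Unset Printing Implicit Defensive.

Import GroupScope Order.TTheory GRing.Theory Num.Theory.
Local Open Scope ring_scope.

Local Notation "m # s" := [multinom m (s i) | i < _]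
  (at level 40, left associativity, format "m # s").

(** * Power sums and alternants *)

Section Alternants.
Variables (N : nat) (R : comNzRingType).
Implicit Types (b m : 'X_{1..N}) (P : {mpoly R[N]}).

Definition psum q : {mpoly R[N]} := \sum_(i < N) 'X_i ^+ q.

Lemma psumE q : psum q = \sum_(i < N) 'X_[U_(i) *+ q].
Proof. by apply: eq_bigr => i _; rewrite mpolyXn. Qed.

Lemma mcoeffMX_le P m k : (P * 'X_[m])@_k = if (m <= k)%MM then P@_(k - m) else 0.
Proof.
case: ifPn => [le_mk|]; first by rewrite -[in LHS](submK le_mk) addmC mcoeffMX.
move=> nle; rewrite mcoeffM big1 // => -[k1 k2] /= /eqP kE.
rewrite mcoeffX; case: eqP => [mE|_]; last by rewrite mulr0.
by move: nle; rewrite [X in (_ <= X)%MM]kE mE lem_addl.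
Qed.

Lemma lemU i q m : (U_(i) *+ q <= m)%MM = (q <= m i)%N.
Proof.
apply/mnm_lepP/idP => [/(_ i)|le j]; first by rewrite mulmnE mnm1E eqxx mul1n.
by rewrite mulmnE mnm1E; case: eqP => [<-|]; rewrite ?mul1n.
Qed.

Lemma mcoeff_mul_psum P q m :
  (P * psum q)@_m = \sum_(i < N | (q <= m i)%N) P@_(m - U_(i) *+ q).
Proof.
rewrite psumE mulr_sumr raddf_sum /= [RHS]big_mkcond /=.
by apply: eq_bigr => i _; rewrite mcoeffMX_le lemU.
Qed.

Lemma mulUE i q j : (U_(i) *+ q : 'X_{1..N})%MM j = if i == j then q else 0%N.
Proof. by rewrite mulmnE mnm1E; case: (i == j); rewrite ?mul1n. Qed.

Lemma msym_psum s q : msym s (psum q) = psum q.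
Proof.
rewrite psumE raddf_sum /= (reindex_inj (@perm_inj _ s^-1)) /=.
apply: eq_bigr => i _; rewrite msymX; congr 'X_[_]; apply/mnmP => j.
by rewrite !mnmE !mulUE (inj_eq perm_inj).
Qed.

(** Coefficients of alternating polynomials change sign when two exponents are
    exchanged, and so vanish at tuples with a repeated entry: only beta-sets
    survive. *)
Definition alternating P := forall s : 'S_N, msym s P = (-1) ^+ s *: P.

Lemma alternating_mcoeff P (s : 'S_N) m :
  alternating P -> P@_(m#s) = (-1) ^+ s * P@_m.
Proof. by move=> altP; rewrite -mcoeff_sym altP mcoeffZ. Qed.

Lemma alternatingM P Q :
  alternating P -> (forall s, msym s Q = Q) -> alternating (P * Q).
Proof. by move=> altP symQ s; rewrite msymM altP symQ scalerAl. Qed.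

Definition alternant b : {mpoly R[N]} := \sum_(s : 'S_N) (-1) ^+ s *: 'X_[b#s].

Lemma alternant_alternating b : alternating (alternant b).
Proof.
move=> t; rewrite raddf_sum scaler_sumr /= (reindex_inj (mulgI t)) /=.
apply: eq_bigr => s _; rewrite msymZ msymX scalerA -mpermM mulKg.
by rewrite odd_permM signr_addb.
Qed.

Lemma alternant_perm b (t : 'S_N) : alternant (b#t) = (-1) ^+ t *: alternant b.
Proof.
rewrite scaler_sumr [RHS](reindex_inj (mulIg t)) /=.
apply: eq_bigr => s _; rewrite -mpermM scalerA; congr (_ *: _).
by rewrite odd_permM signr_addb mulrC -mulrA -signr_addb addbb mulr1.
Qed.

Lemma mcoeff_alternant b m :
  (alternant b)@_m = \sum_(s : 'S_N | b#s == m) (-1) ^+ s.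
Proof.
rewrite raddf_sum [RHS]big_mkcond /=; apply: eq_bigr => s _.
by rewrite mcoeffZ mcoeffX; case: eqP; rewrite ?mulr1 ?mulr0.
Qed.

Lemma mcoeff_alternant_id b : injective b -> (alternant b)@_b = 1.
Proof.
move=> inj_b; rewrite mcoeff_alternant (bigD1 1%g) /=; last by rewrite mperm1.
rewrite odd_perm1 big1 ?addr0 // => s /andP[/eqP/mnmP bs].
case/eqP; apply/permP => i; rewrite perm1; apply: inj_b.
by rewrite -[RHS]bs mnmE.
Qed.

(** The exponent [delta] of the Vandermonde product, which is the alternant of
    [stair]. *)
Definition stair : 'X_{1..N} := [multinom (i : nat) | i < N].

Lemma stair_inj : injective stair.
Proof. by move=> i j; rewrite !mnmE => /val_inj. Qed.

Lemma mdeg_stair : (mdeg stair).*2 = (N * N.-1)%N.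
Proof.
rewrite mdegE (eq_bigr (fun i : 'I_N => i : nat)); last by move=> i _; rewrite mnmE.
rewrite -(big_mkord xpredT id) /= bin2_sum bin2.
by rewrite -[RHS](odd_double_half) oddM; case: (N) => //= k; rewrite andNb.
Qed.

(** The Murnaghan-Nakayama rule for adding hooks: the alternants with a repeated
    exponent vanish, and sorting the others produces the signs. *)
Lemma alternant_mul_psum b q :
  alternant b * psum q = \sum_(i < N) alternant (b + U_(i) *+ q).
Proof.
rewrite psumE mulr_suml exchange_big /=; apply: eq_bigr => s _.
rewrite mulr_sumr (reindex_inj (@perm_inj _ s)) /= [RHS](reindex_inj (@perm_inj _ s)) /=.
rewrite [LHS](reindex_inj (@perm_inj _ s^-1)) /=.
apply: eq_bigr => i _; rewrite -scalerAl -mpolyXD; congr (_ *: 'X_[_]).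
apply/mnmP => j; rewrite !mnmE !mulUE permKV.
by rewrite (inj_eq perm_inj).
Qed.

End Alternants.

Section NumAlternants.
Variables (N : nat) (R : numDomainType).
Implicit Types (b m : 'X_{1..N}) (P : {mpoly R[N]}).

Lemma alternating_mcoeff0 P m (i j : 'I_N) :
  alternating P -> i != j -> m i = m j -> P@_m = 0.
Proof.
move=> altP ij mij; have := alternating_mcoeff (tperm i j) m altP.
rewrite odd_tperm ij expr1 mulN1r.
have -> : m#(tperm i j) = m.
  by apply/mnmP => k; rewrite mnmE; case: tpermP => [->|->|].
by move/eqP; rewrite -addr_eq0 -mulr2n mulrn_eq0 => /eqP.
Qed.

Lemma alternating_neq0_inj P m : alternating P -> P@_m != 0 -> injective m.
Proof.
move=> altP nz i j mij; apply/eqP/negPn/negP => ij.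
by rewrite (alternating_mcoeff0 altP ij mij) eqxx in nz.
Qed.

Lemma alternant_eq0 b (i j : 'I_N) : i != j -> b i = b j -> alternant R b = 0.
Proof.
move=> ij bij; have := alternant_perm R b (tperm i j).
rewrite odd_tperm ij expr1 scaleN1r.
have -> : b#(tperm i j) = b.
  by apply/mnmP => k; rewrite mnmE; case: tpermP => [->|->|].
move/eqP; rewrite -addr_eq0 -mulr2n => /eqP E; apply/mpolyP => m.
by move/(congr1 (mcoeff m)): E; rewrite mcoeffMn !mcoeff0 => /eqP; rewrite mulrn_eq0 => /eqP.
Qed.
End NumAlternants.

Section Transfer.
Variables (N : nat) (R : numDomainType).
Implicit Types (b m : 'X_{1..N}) (P : {mpoly R[N]}).

Lemma mpolyMn_inj n : (0 < n)%N -> injective (fun P => P *+ n).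
Proof.
move=> n_gt0 P Q /= E; apply/mpolyP => m; move/(congr1 (mcoeff m)): E.
by rewrite !mcoeffMn => /eqP; rewrite eqrMn2r => /predU1P[n0|/eqP //]; rewrite n0 in n_gt0.
Qed.

(** The indices [t] and [s - t] contribute opposite terms. *)
Lemma sum_antisym_eq0 (f : nat -> {mpoly R[N]}) s :
  (forall t, (t <= s)%N -> f (s - t)%N = - f t) -> \sum_(0 <= t < s.+1) f t = 0.
Proof.
move=> f_anti; apply: (@mpolyMn_inj 2) => //=; rewrite mul0rn mulr2n.
rewrite [X in _ + X]big_nat_rev /= -big_split big_nat big1 // => t /andP[_ lt].
by rewrite add0n subSS f_anti //= subrr.
Qed.

(** The exponents of [b] at [i] and [j] are redistributed in all ways that keep
    their sum; exchanging the two values pairs the resulting alternants off. *)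
Lemma alternant_transfer b (i j : 'I_N) : i != j ->
  \sum_(1 <= q < (b j).+1) alternant R (b - U_(j) *+ q + U_(i) *+ q) +
  \sum_(1 <= q < (b i).+1) alternant R (b - U_(i) *+ q + U_(j) *+ q)
  = - alternant R b.
Proof.
move=> ij; pose s := (b i + b j)%N.
pose upd t : 'X_{1..N} :=
  [multinom if k == i then t else if k == j then (s - t)%N else b k | k < N].
have jiF : (j == i) = false by rewrite eq_sym (negbTE ij).
have := @sum_antisym_eq0 (fun t => alternant R (upd t)) s.
have anti t : (t <= s)%N -> alternant R (upd (s - t)%N) = - alternant R (upd t).
  move=> le_ts; rewrite -scaleN1r -(expr1 (-1)) -[1%N]/(nat_of_bool true).
  have <- : odd_perm (tperm i j) = true by rewrite odd_tperm ij.
  rewrite -alternant_perm; congr alternant; apply/mnmP => k; rewrite !mnmE.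
  by case: tpermP => [->|->|/eqP/negbTE-> /eqP/negbTE->]; rewrite ?eqxx ?jiF ?subKn.
move=> /(_ anti).
rewrite (@big_cat_nat _ _ _ (b i)) //=; last by rewrite /s; lia.
rewrite [X in _ + X]big_nat_recl /=; last by rewrite /s; lia.
have -> : upd (b i) = b.
  apply/mnmP => k; rewrite mnmE; case: eqP => [->//|_]; case: eqP => [->|//].
  by rewrite /s addKn.
move=> E; apply/eqP; rewrite -addr_eq0; apply/eqP; rewrite -{}[RHS]E.
rewrite addrAC addrC; congr (_ + _).
  rewrite big_nat_rev /= big_add1 /= !big_mkord.
  apply: eq_bigr => q _; congr alternant; apply/mnmP => k.
  rewrite !mnmE !mulUE /= !(eq_sym _ k).
  have := ltn_ord q; case: (eqVneq k i) => [->|_]; rewrite ?(negbTE ij); first by lia.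
  by case: eqP => [->|_]; rewrite /s; lia.
rewrite addrC; congr (_ + _); rewrite big_add1 /=.
rewrite -{1}[b i]add0n big_addn.
have -> : (s - b i = b j)%N by rewrite /s; lia.
rewrite !big_mkord; apply: eq_bigr => q _; congr alternant; apply/mnmP => k.
rewrite !mnmE !mulUE /= !(eq_sym _ k).
have := ltn_ord q; case: (eqVneq k i) => [->|_]; rewrite ?(negbTE ij); first by lia.
by case: eqP => [->|_]; rewrite /s; lia.
Qed.

End Transfer.

Section NewtonBound.
Variables (N : nat) (R : numDomainType).
Implicit Types (b m : 'X_{1..N}) (P : {mpoly R[N]}).

(** Moving [q] units from the entry [j] to the entry [i] gives back [b] when
    [i = j], hence [mdeg b] copies of its alternant. For [i <> j] the two
    directions of transfer together contribute [-1] copy, by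
    [alternant_transfer], hence [mdeg (stair N)] copies to be subtracted. *)
Lemma alternant_newton_bound b n M :
    mdeg b = (n + mdeg (stair N))%N -> (forall j, b j <= M)%N ->
  \sum_(1 <= q < M.+1) \sum_(j < N | (q <= b j)%N)
     alternant R (b - U_(j) *+ q) * psum N R q = alternant R b *+ n.
Proof.
move=> deg_b le_bM.
pose T (j i : 'I_N) q := alternant R (b - U_(j) *+ q + U_(i) *+ q).
pose X j i := \sum_(1 <= q < (b j).+1) T j i q.
have -> : \sum_(1 <= q < M.+1) \sum_(j < N | (q <= b j)%N)
     alternant R (b - U_(j) *+ q) * psum N R q = \sum_j \sum_i X j i.
  under eq_bigr => q _ do rewrite big_mkcond.
  rewrite exchange_big /=; apply: eq_bigr => j _; rewrite exchange_big /=.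
  rewrite (@big_cat_nat _ _ _ (b j).+1) //=; last exact: leq_ltn_trans (le_bM j) _.
  rewrite [X in _ + X]big_nat [X in _ + X]big1 ?addr0; last first.
    by move=> q /andP[lt _]; rewrite leqNgt lt.
  apply: eq_big_nat => q /andP[_ lt]; rewrite -ltnS lt.
  by rewrite alternant_mul_psum.
have diag i : X i i = alternant R b *+ b i.
  rewrite /X (eq_big_nat _ _ (F2 := fun=> alternant R b)); last first.
    by move=> q /andP[_ lt]; rewrite /T submK // lemU.
  by rewrite big_const_nat subn1 iter_addr_0.
(* Doubling lets the sum over ordered pairs absorb both directions of transfer. *)
apply: (@mpolyMn_inj _ _ 2) => //=.
have -> : \sum_j \sum_i X j i =
    alternant R b *+ mdeg b + \sum_j \sum_(i | i != j) X j i.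
  rewrite mdegE -sumrMnr -big_split /=; apply: eq_bigr => j _.
  by rewrite (bigD1 j) //= diag.
rewrite mulrnDl.
have -> : (\sum_j \sum_(i | i != j) X j i) *+ 2 = - (alternant R b *+ (N * N.-1)).
  under eq_bigr => j _ do rewrite big_mkcond.
  rewrite mulr2n [X in _ + X]exchange_big -big_split /=.
  rewrite (eq_bigr (fun=> - (alternant R b *+ N.-1))).
    by rewrite sumr_const card_ord -mulNrn -mulNrn -mulrnA mulnC.
  move=> j _; rewrite -mulNrn -big_split /=.
  rewrite (eq_bigr (fun i => if i != j then - alternant R b else 0)); last first.
    move=> i _; rewrite (eq_sym j); case: ifP => [ij|_]; last by rewrite addr0.
    by rewrite -(alternant_transfer R b ij).
  rewrite -big_mkcond sumr_const; congr (_ *+ _).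
  by have := cardC1 j; rewrite card_ord => <-; apply: eq_card.
rewrite -!mulrnA deg_b -mdeg_stair -muln2 mulnDl mulrnDr.
by rewrite addrK.
Qed.

End NewtonBound.

(** * Cores and weights *)

Section Cores.
Variable N : nat.
Implicit Types (b m : 'X_{1..N}).

(** On an abacus with [q] runners the entries of [b] are beads, and those
    congruent to [b i] share its runner: [runner_rank] is the position that the
    bead [i] reaches once every bead has slid down as far as possible. The core
    keeps the beads labelled by their index, because signs depend on the order
    of the entries. *)
Definition runner_rank q b (i : 'I_N) :=
  #|[set j : 'I_N | (b j < b i)%N && (b j == b i %[mod q])]|.

Definition core q b : 'X_{1..N} :=
  [multinom (q * runner_rank q b i + b i %% q)%N | i < N].

(** The number of hooks of length [q] that can be removed in succession from the
    partition encoded by [b]. *)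
Definition weight q b := (\sum_(i < N) (b i %/ q - runner_rank q b i))%N.

Lemma runner_rank_lt q b i j :
  (b i < b j)%N -> b i = b j %[mod q] -> (runner_rank q b i < runner_rank q b j)%N.
Proof.
move=> lt_ij ij_q; apply: proper_card; apply/properP; split.
  apply/subsetP => k; rewrite !inE => /andP[lt_ki /eqP ->].
  by rewrite (ltn_trans lt_ki) //= ij_q.
by exists i; rewrite !inE ?ltnn // lt_ij ij_q eqxx.
Qed.

(** Distinct beads on a runner have distinct quotients by [q]. *)
Lemma runner_rank_le q b i :
  (0 < q)%N -> injective b -> (runner_rank q b i <= b i %/ q)%N.
Proof.
move=> q_gt0 inj_b; rewrite /runner_rank cardE.
set s := enum _.
have -> : size s = size [seq (b j %/ q)%N | j <- s] by rewrite size_map.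
rewrite -[leqRHS](size_iota 0); apply: uniq_leq_size.
  rewrite map_inj_in_uniq ?enum_uniq // => j k.
  rewrite !mem_enum !inE => /andP[_ /eqP jq] /andP[_ /eqP kq] jk.
  by apply: inj_b; rewrite (divn_eq (b j) q) jk jq -kq -divn_eq.
move=> x /mapP[j]; rewrite mem_enum inE => /andP[lt_ji /eqP jq] ->.
rewrite mem_iota add0n /= ltnNge; apply: contraL lt_ji => le.
by rewrite -leqNgt [leqLHS](divn_eq _ q) [leqRHS](divn_eq _ q) jq leq_add2r leq_mul2r le orbT.
Qed.

Lemma core_mod q b i : core q b i = b i %[mod q].
Proof. by rewrite mnmE mulnC modnMDl modn_mod. Qed.

Lemma core_inj q b : (0 < q)%N -> injective b -> injective (core q b).
Proof.
move=> q_gt0 inj_b i j E.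
have Emod : b i = b j %[mod q] by rewrite -(core_mod q b i) -(core_mod q b j) E.
move: E; rewrite !mnmE Emod => /addIn/eqP; rewrite eqn_mul2l gtn_eqF //= => /eqP E.
case: (ltngtP (b i) (b j)) => [lt|lt|/inj_b //].
- by have := runner_rank_lt lt Emod; rewrite E ltnn.
- by have := runner_rank_lt lt (esym Emod); rewrite E ltnn.
Qed.

Lemma mdeg_core q b : (0 < q)%N -> injective b ->
  mdeg b = (q * weight q b + mdeg (core q b))%N.
Proof.
move=> q_gt0 inj_b; rewrite !mdegE big_distrr /= -big_split /=.
apply: eq_bigr => i _; rewrite mnmE addnA -mulnDr subnK ?runner_rank_le //.
by rewrite mulnC -divn_eq.
Qed.

Lemma weight_eq0_core q b : (0 < q)%N -> injective b -> weight q b = 0%N ->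
  core q b = b.
Proof.
move=> q_gt0 inj_b /eqP; rewrite sum_nat_eq0 => /forallP w0; apply/mnmP => i.
rewrite mnmE [RHS](divn_eq _ q) mulnC; congr (_ * _ + _)%N.
by apply/eqP; rewrite eqn_leq runner_rank_le //= -subn_eq0; have := w0 i.
Qed.

(** Two congruent entries are comparable, so the runner ranks add up to the
    number of congruent pairs, which depends on residues alone. *)
Lemma sum_runner_rank q b : injective b ->
  (\sum_(i < N) runner_rank q b i =
   \sum_(i < N) \sum_(j < N | (i < j)%N) (b i == b j %[mod q]))%N.
Proof.
move=> inj_b; apply: double_inj; rewrite -!addnn.
pose c (i j : 'I_N) : nat := b i == b j %[mod q].
have cC i j : c i j = c j i by rewrite /c eq_sym.
have rankE (i : 'I_N) : runner_rank q b i = (\sum_j (b j < b i) * c j i)%N.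
  rewrite /runner_rank -sum1_card big_mkcond /=; apply: eq_bigr => j _.
  by rewrite inE /c; case: (_ < _)%N => //=; rewrite mul1n; case: (_ == _).
under eq_bigr => i _ do rewrite rankE.
rewrite [in X in (_ + X)%N]exchange_big -big_split /=.
under [in RHS]eq_bigr => i _ do rewrite big_mkcond.
rewrite [in X in (_ = _ + X)%N]exchange_big -big_split /=.
apply: eq_bigr => i _; rewrite -!big_split; apply: eq_bigr => j _ /=.
rewrite (cC j i) -/(c i j) -/(c j i) (cC j i).
have [->|ij] := eqVneq i j; first by rewrite !ltnn.
have : b i != b j by apply: contra ij => /eqP/inj_b->.
have : (i : nat) != j by [].
by case: (ltngtP i j); case: (ltngtP (b i) (b j)) => //=; rewrite ?mul1n ?mul0n ?addn0.
Qed.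

(** Without any subtraction, the form in which the weight meets Legendre's formula. *)
Lemma weightE q b : (0 < q)%N -> injective b ->
  (\sum_(i < N) b i %/ q =
   weight q b + \sum_(i < N) \sum_(j < N | (i < j)%N) (b i == b j %[mod q]))%N.
Proof.
move=> q_gt0 inj_b; rewrite -sum_runner_rank // -big_split /=.
by apply: eq_bigr => i _; rewrite subnK // runner_rank_le.
Qed.

(** Congruent tuples have the same congruent pairs, so that their weights differ
    exactly by the difference of their degrees divided by [q]. *)
Lemma weight_congr q b b' : (0 < q)%N -> injective b -> injective b' ->
    (forall i, b i = b' i %[mod q]) ->
  (q * weight q b + mdeg b' = q * weight q b' + mdeg b)%N.
Proof.
move=> q_gt0 inj_b inj_b' bb'.
have degE c : mdeg c = (q * (\sum_(i < N) c i %/ q) + \sum_(i < N) c i %% q)%N.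
  rewrite mdegE big_distrr /= -big_split; apply: eq_bigr => i _ /=.
  by rewrite mulnC -divn_eq.
rewrite (degE b) (degE b') !weightE // (eq_bigr _ (fun i _ => bb' i)).
have -> : (\sum_(i < N) \sum_(j < N | (i < j)%N) (b i == b j %[mod q]) =
   \sum_(i < N) \sum_(j < N | (i < j)%N) (b' i == b' j %[mod q]))%N.
  by apply: eq_bigr => i _; apply: eq_bigr => j _; rewrite !bb'.
by rewrite !mulnDr -!addnA addnCA.
Qed.

End Cores.

Section HookRemoval.
Variable N : nat.
Implicit Types (b m : 'X_{1..N}).

(** With a single runner all beads slide down to [0, ..., N - 1]. *)
Lemma core1_stair b : injective b -> exists s : 'S_N, core 1 b = (stair N)#s.
Proof.
move=> inj_b; have inj_c := core_inj (isT : 0 < 1)%N inj_b.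
have lt_c i : (core 1 b i < N)%N.
  rewrite mnmE mul1n modn1 addn0 -[X in (_ < X)%N](card_ord N).
  rewrite -[X in (_ < X)%N]cardsT; apply: proper_card; apply/properP.
  by split; [apply: subsetT | exists i; rewrite !inE ?ltnn].
have inj_f : injective (fun i => Ordinal (lt_c i)).
  by move=> i j [] /inj_c.
by exists (perm inj_f); apply/mnmP => i; rewrite [RHS]mnmE permE [RHS]mnmE.
Qed.

Lemma mdeg_core1 b : injective b -> mdeg (core 1 b) = mdeg (stair N).
Proof. by move=> /core1_stair[s ->]; rewrite mdeg_mperm. Qed.

Lemma mdeg_weight1 b : injective b -> mdeg b = (weight 1 b + mdeg (stair N))%N.
Proof. by move=> inj_b; rewrite (mdeg_core (q:=1)) // mdeg_core1 // mul1n. Qed.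

Lemma inj_stairP b : injective b -> mdeg b = mdeg (stair N) ->
  exists s : 'S_N, b = (stair N)#s.
Proof.
move=> inj_b; rewrite mdeg_weight1 // -[RHS]add0n => /addIn w0.
by have [s cE] := core1_stair inj_b; exists s; rewrite -cE weight_eq0_core.
Qed.

Variable R : numDomainType.
Implicit Types P : {mpoly R[N]}.

Lemma noninj_alternant b : ~~ injectiveb b -> alternant R b = 0.
Proof. by case/injectivePn => i [j ij bij]; apply: (alternant_eq0 _ ij bij). Qed.

Lemma alternant_mdeg_lt b : (mdeg b < mdeg (stair N))%N -> alternant R b = 0.
Proof.
move=> lt_b; apply: noninj_alternant; apply: contraL lt_b => /injectiveP inj_b.
by rewrite -leqNgt (mdeg_weight1 inj_b) leq_addl.
Qed.

Lemma mdegB_U b q i : (q <= b i)%N -> (mdeg (b - U_(i) *+ q) + q)%N = mdeg b.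
Proof.
move=> le; rewrite -{2}(submK (m := U_(i) *+ q) (m' := b)) ?lemU // mdegD.
by rewrite mdegMn mdeg1 mul1n.
Qed.

(** Newton's identity [n h_n = sum_q p_q h_(n-q)], as it acts on alternants; a
    move by more than [n] leaves too small a degree for distinct entries. *)
Lemma alternant_newton b n : mdeg b = (n + mdeg (stair N))%N ->
  \sum_(1 <= q < n.+1) \sum_(j < N | (q <= b j)%N)
     alternant R (b - U_(j) *+ q) * psum N R q = alternant R b *+ n.
Proof.
move=> deg_b; rewrite -(alternant_newton_bound (M := mdeg b) R deg_b); last first.
  by move=> j; rewrite mdegE (bigD1 j) //= leq_addr.
rewrite [RHS](@big_cat_nat _ _ _ n.+1) //=; last by rewrite deg_b ltnS leq_addr.
rewrite [X in _ = _ + X]big_nat [X in _ = _ + X]big1 ?addr0 // => q /andP[lt_nq _].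
rewrite big1 // => j le_qb; rewrite alternant_mdeg_lt ?mul0r //.
by have := mdegB_U le_qb; lia.
Qed.

(** The lowest bead that is above its final position can slide down. *)
Lemma exists_free_move q b : (0 < q)%N -> injective b -> (0 < weight q b)%N ->
  exists i, (q <= b i)%N /\ injective (b - U_(i) *+ q)%MM.
Proof.
move=> q_gt0 inj_b w_gt0.
have [i0 lt0] : exists i, (runner_rank q b i < b i %/ q)%N.
  apply/existsP; apply: contraLR w_gt0; rewrite negb_exists => /forallP h.
  rewrite -eqn0Ngt sum_nat_eq0; apply/forallP => i; rewrite /= subn_eq0 leqNgt.
  exact: h.
pose i := [arg min_(i < i0 | (runner_rank q b i < b i %/ q)%N) b i].
have [lt_i min_i] : (runner_rank q b i < b i %/ q)%N /\
    forall j, (runner_rank q b j < b j %/ q)%N -> (b i <= b j)%N.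
  by rewrite /i; case: arg_minnP.
have le_qi : (q <= b i)%N by rewrite leqNgt; apply: contraTN lt_i => /divn_small->.
exists i; split=> // j k; rewrite !mnmE !mulUE.
have free l : b l <> (b i - q)%N.
  move=> bl; have lt_li : (b l < b i)%N by lia.
  have modE : b l = b i %[mod q] by rewrite bl -[in RHS](subnK le_qi) modnDr.
  have := runner_rank_lt lt_li modE.
  have : (b l %/ q <= runner_rank q b l)%N.
    by rewrite leqNgt; apply: contraL lt_li => /min_i; rewrite -leqNgt.
  have quoE : (b i %/ q = (b l %/ q).+1)%N.
    by rewrite bl -{1}(subnK le_qi) divnDr ?dvdnn // divnn q_gt0 addn1.
  move=> le_l lt_l; move: lt_i; rewrite quoE ltnS leqNgt.
  by rewrite (leq_ltn_trans le_l lt_l).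
case: eqVneq => [<-|ij]; case: eqVneq => [<-|ik] //; rewrite ?subn0.
- by move/esym/free.
- by move/free.
- exact: inj_b.
Qed.

(** Beads of a runner cannot overtake each other, so that a legal slide does not
    change the final position of any of them. *)
Lemma core_move q b i : (0 < q)%N -> injective b -> (q <= b i)%N ->
  injective (b - U_(i) *+ q)%MM -> core q (b - U_(i) *+ q) = core q b.
Proof.
move=> q_gt0 inj_b le_qi; set b' := (b - _)%MM => inj_b'.
have b'E j : b' j = (b j - (if i == j then q else 0))%N by rewrite !mnmE mulUE.
have modE j : b' j = b j %[mod q].
  rewrite b'E; case: eqP => [<-|]; last by rewrite subn0.
  by rewrite -[in RHS](subnK le_qi) modnDr.
apply/mnmP => j; rewrite [LHS]mnmE [RHS]mnmE modE; congr (_ * _ + _)%N.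
apply: eq_card => k; rewrite !inE !modE.
have [/eqP kj|] := boolP (b k == b j %[mod q]); last by rewrite !andbF.
rewrite !andbT; have [->|neq_kj] := eqVneq k j; first by rewrite !ltnn.
have neq_b : b k != b j by apply: contra neq_kj => /eqP/inj_b->.
have neq_b' : b' k != b' j by apply: contra neq_kj => /eqP/inj_b'->.
have kj' : b' k = b' j %[mod q] by rewrite !modE.
have quo x y : x = y %[mod q] -> x != y -> (x < y)%N = (x %/ q < y %/ q)%N.
  move=> xy ne; have := divn_eq x q; have := divn_eq y q; rewrite xy => yE xE.
  have := ltn_mul2r q (x %/ q) (y %/ q); rewrite q_gt0 /= => <-.
  by rewrite -(ltn_add2r (y %% q) (x %/ q * q)) -xE -yE.
have ne_quo x y : x = y %[mod q] -> x != y -> (x %/ q != y %/ q)%N.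
  by move=> xy; apply: contra => /eqP E; rewrite (divn_eq x q) E xy -divn_eq.
rewrite (quo _ _ kj neq_b) (quo _ _ kj' neq_b'); have := ne_quo _ _ kj neq_b; have := ne_quo _ _ kj' neq_b'.
rewrite !b'E; case: (eqVneq i k) => [ik|_]; case: (eqVneq i j) => [ij|_]; rewrite ?subn0.
- by rewrite -ik -ij eqxx.
- rewrite -{}ik in kj neq_b *; have -> : (b i %/ q = ((b i - q) %/ q).+1)%N.
    by rewrite -{1}(subnK le_qi) divnDr ?dvdnn // divnn q_gt0 addn1.
  lia.
- rewrite -{}ij in kj neq_b *; have -> : (b i %/ q = ((b i - q) %/ q).+1)%N.
    by rewrite -{1}(subnK le_qi) divnDr ?dvdnn // divnn q_gt0 addn1.
  lia.
- by [].
Qed.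

Lemma weight_move q b i : (0 < q)%N -> injective b -> (q <= b i)%N ->
  injective (b - U_(i) *+ q)%MM -> weight q b = (weight q (b - U_(i) *+ q)).+1.
Proof.
move=> q_gt0 inj_b le_qi inj_b'.
have := mdeg_core q_gt0 inj_b; have := mdeg_core q_gt0 inj_b'.
by rewrite core_move // -(mdegB_U le_qi); nia.
Qed.

(** The expansion runs over all sequences of [weight q b] slides. Those that make
    two beads collide contribute nothing, since the coefficients are alternating;
    all others end in the same tuple [core q b], with its entries in the same
    order. So no two contributions have opposite signs, and [c] counts the legal
    sequences. *)
Lemma mcoeff_mul_psum_core q b P : (0 < q)%N -> injective b -> alternating P ->
  exists2 c, (0 < c)%N &
    (P * psum N R q ^+ weight q b)@_b = c%:R * P@_(core q b).
Proof.
move=> q_gt0 inj_b altP; move wE : (weight q b) => w.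
elim: w b inj_b wE => [|w IHw] b inj_b wE.
  by exists 1%N; rewrite // mul1r expr0 mulr1 weight_eq0_core.
have altPw : alternating (P * psum N R q ^+ w).
  by apply: alternatingM => // s; rewrite rmorphXn /= msym_psum.
have step i : exists c, (q <= b i)%N ->
    (P * psum N R q ^+ w)@_(b - U_(i) *+ q) = c%:R * P@_(core q b) /\
    (injective (b - U_(i) *+ q)%MM -> 0 < c)%N.
  have [le_qi|_] := boolP (q <= b i)%N; last by exists 0%N.
  have [/injectiveP inj_b'|ninj] := boolP (injectiveb (b - U_(i) *+ q)%MM); last first.
    exists 0%N => _; split; last by move/injectiveP; rewrite (negbTE ninj).
    by rewrite mul0r; apply/eqP; apply: contraNT ninj => /(alternating_neq0_inj altPw)/injectiveP.
  have := weight_move q_gt0 inj_b le_qi inj_b'; rewrite wE => -[/esym w'E].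
  have [c c_gt0 cE] := IHw _ inj_b' w'E.
  by exists c => _; split=> //; rewrite cE core_move.
have [c cP] := fin_all_exists step.
exists (\sum_(i | q <= b i) c i)%N.
  have [i [le_qi inj_b']] : exists i, (q <= b i)%N /\ injective (b - U_(i) *+ q)%MM.
    by apply: exists_free_move; rewrite ?wE.
  by rewrite (bigD1 i) //= ltn_addr //; have [_ ->] := cP i le_qi.
rewrite exprSr mulrA mcoeff_mul_psum natr_sum mulr_suml.
by apply: eq_bigr => i le_qi; have [-> _] := cP i le_qi.
Qed.

End HookRemoval.

(** * Counting fixed words *)

Section FixedWords.
Variable n : nat.

(** A word fixed by [s] is constant on the cycles of [s], so this is the product
    over these cycles of the power sums of the family [z]. Summing over words
    avoids any reference to the cycles. *)
Definition fixsum (A : finType) (S : comNzRingType) (z : A -> S) (s : 'S_n) : S :=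
  \sum_(f : {ffun 'I_n -> A} | [forall k, f (s k) == f k]) \prod_k z (f k).

Lemma fixsum_pair (A B : finType) (S : comNzRingType) (x : A -> S) (y : B -> S) s :
  fixsum (fun c : A * B => x c.1 * y c.2) s = fixsum x s * fixsum y s.
Proof.
rewrite /fixsum big_distrlr /= pair_big /=.
rewrite [RHS](reindex (fun h : {ffun 'I_n -> A * B} =>
   ([ffun k => (h k).1], [ffun k => (h k).2]))) /=; last first.
  exists (fun p : {ffun 'I_n -> A} * {ffun 'I_n -> B} => [ffun k => (p.1 k, p.2 k)]).
    by move=> h _; apply/ffunP => k; rewrite !ffunE -surjective_pairing.
  by case=> f g _; congr (_, _); apply/ffunP => k; rewrite !ffunE.
apply: eq_big => [h|h _].
  apply/forallP/andP => [hs|[/forallP h1 /forallP h2] k].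
    by split; apply/forallP => k; rewrite !ffunE (eqP (hs k)).
  by have := h1 k; have := h2 k; rewrite !ffunE -pair_eqE /= => -> ->.
by rewrite -big_split; apply: eq_bigr => k _; rewrite !ffunE.
Qed.

Lemma fixsum_bij (A B : finType) (S : comNzRingType) (e : A -> B) (z : B -> S) s :
  bijective e -> fixsum (fun a => z (e a)) s = fixsum z s.
Proof.
move=> [e' eK e'K]; rewrite /fixsum.
rewrite [RHS](reindex (fun h : {ffun 'I_n -> A} => [ffun k => e (h k)])) /=; last first.
  exists (fun h : {ffun 'I_n -> B} => [ffun k => e' (h k)]) => h _;
    by apply/ffunP => k; rewrite !ffunE.
apply: eq_big => [h|h _]; last by apply: eq_bigr => k _; rewrite ffunE.
by apply: eq_forallb => k; rewrite !ffunE (can_eq eK).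
Qed.

Lemma rmorph_fixsum (A : finType) (S S' : comNzRingType) (phi : {rmorphism S -> S'})
  (z : A -> S) s : phi (fixsum z s) = fixsum (fun a => phi (z a)) s.
Proof. by rewrite rmorph_sum; apply: eq_bigr => f _; rewrite rmorph_prod. Qed.

Lemma eq_fixsum (A : finType) (S : comNzRingType) (z z' : A -> S) s :
  z =1 z' -> fixsum z s = fixsum z' s.
Proof. by move=> zz'; apply: eq_bigr => f _; apply: eq_bigr => k _. Qed.

Section Content.
Variable k : nat.
Implicit Types (f g : {ffun 'I_n -> 'I_k}) (m : 'X_{1..k}).

Definition content f : 'X_{1..k} := (\sum_l U_(f l))%MM.

Lemma contentE f i : content f i = (\sum_l (f l == i))%N.
Proof. by rewrite mnm_sumE; apply: eq_bigr => l _; rewrite mnm1E. Qed.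

Lemma mdeg_content f : mdeg (content f) = n.
Proof.
rewrite mdeg_sum (eq_bigr (fun=> 1%N)) ?sum1_card ?card_ord // => l _.
by rewrite mdeg1.
Qed.

Definition word_act f (s : 'S_n) : {ffun 'I_n -> 'I_k} := [ffun l => f (s l)].

Lemma word_actM f s t : word_act f (s * t) = word_act (word_act f t) s.
Proof. by apply/ffunP => l; rewrite !ffunE permM. Qed.

Lemma word_act1 f : word_act f 1 = f.
Proof. by apply/ffunP => l; rewrite !ffunE perm1. Qed.

Lemma content_act f s : content (word_act f s) = content f.
Proof.
apply/mnmP => i; rewrite !contentE [RHS](reindex_inj (@perm_inj _ s)) /=.
by apply: eq_bigr => l _; rewrite ffunE.
Qed.

Lemma content_eqP f g : content f = content g -> exists t, f = word_act g t.
Proof.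
move=> fg; pose t h := [tuple h l | l < n] : n.-tuple 'I_k.
have : perm_eq (t f) (t g).
  apply/allP => i _ /=; move/mnmP/(_ i): fg; rewrite !contentE.
  have cE h : count_mem i (t h) = (\sum_l (h l == i))%N.
    by rewrite -sum1_count big_mkcond /= big_map big_enum /=; apply: eq_bigr => l _; case: eqP.
  by rewrite !cE => ->.
case/tuple_permP => s E; exists s; apply/ffunP => l; rewrite ffunE.
have := congr1 (fun u => tnth u l) (val_inj E : t f = [tuple tnth (t g) (s i) | i < n]).
by rewrite !tnth_mktuple.
Qed.

Lemma content_exists m : mdeg m = n -> exists f, content f = m.
Proof.
move=> deg_m.
have [s sE] : exists s : n.-tuple 'I_k, forall i, count_mem i s = m i.
  have size_s : size (flatten [seq nseq (m i) i | i <- enum 'I_k]) == n.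
    rewrite size_flatten /shape -map_comp -deg_m mdegE sumnE big_map big_enum /=.
    by apply/eqP/eq_bigr => i _; rewrite size_nseq.
  exists (Tuple size_s) => i /=.
  rewrite count_flatten -map_comp sumnE big_map big_enum /= (bigD1 i) //=.
  rewrite count_nseq /= eqxx mul1n big1 ?addn0 // => j /negbTE ji.
  by rewrite count_nseq /= ji.
exists [ffun l => tnth s l]; apply/mnmP => i; rewrite contentE -sE.
rewrite -sum1_count [RHS]big_mkcond /= big_tuple.
by apply: eq_bigr => l _; rewrite ffunE; case: eqP.
Qed.

(** Orbit counting: [S_n] is transitive on the words of given content, so the
    stabilisers of all of them contain [n!] elements in total. *)
Lemma card_fixed_words m :
  (\sum_(s : 'S_n) #|[set f | (word_act f s == f) && (content f == m)]|)%N
  = ((mdeg m == n) * n`!)%N.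
Proof.
case: eqP => [deg_m|ndeg]; last first.
  rewrite mul0n big1 // => s _; apply: eq_card0 => f; rewrite inE.
  by apply/negP => /andP[_ /eqP cf]; case: ndeg; rewrite -cf mdeg_content.
have [g cg] := content_exists deg_m; rewrite mul1n -card_Sn -sum1_card.
under [in LHS]eq_bigr => s _ do rewrite -sum1_card big_mkcond.
rewrite exchange_big /=.
rewrite [RHS](partition_big (word_act g) predT) //=; apply: eq_bigr => f _.
under [in LHS]eq_bigr => s _ do rewrite inE.
have [cf|ncf] := altP (content f =P m); last first.
  rewrite big1 => [|s _]; last by rewrite andbF.
  rewrite big_pred0 // => s; apply/negP => /eqP gs; case/negP: ncf.
  by rewrite -gs content_act cg.
have [t ft] : exists t, f = word_act g t by apply: content_eqP; rewrite cf cg.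
rewrite [RHS]big_mkcond [RHS](reindex_inj (mulIg t)) /=; apply: eq_bigr => s _.
by rewrite andbT word_actM -ft.
Qed.

Lemma mcoeff_fixsum (S : comNzRingType) m s :
  (fixsum (fun i : 'I_k => 'X_i : {mpoly S[k]}) s)@_m =
   #|[set f | (word_act f s == f) && (content f == m)]|%:R.
Proof.
rewrite raddf_sum -sum1_card natr_sum [LHS]big_mkcond [RHS]big_mkcond /=.
apply: eq_bigr => f _; rewrite inE mprodXE mcoeffX.
have -> : [forall l, f (s l) == f l] = (word_act f s == f).
  apply/forallP/eqP => [h|/ffunP h l]; first by apply/ffunP => l; rewrite ffunE (eqP (h l)).
  by have := h l; rewrite ffunE => ->.
by case: (_ == f) => //=; rewrite -/(content f); case: (_ == m).
Qed.

End Content.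
End FixedWords.

Section CompleteSymmetric.
Variables (k : nat) (S : comNzRingType).

Definition hsym n : {mpoly S[k]} :=
  \sum_(m : 'X_{1..k < n.+1} | mdeg m == n) 'X_[m].

Lemma mcoeff_hsym n m : (hsym n)@_m = (mdeg m == n)%:R.
Proof.
rewrite raddf_sum /= big_mkcond /=.
have [deg_m|ndeg] := eqVneq; last first.
  rewrite big1 // => m' _; case: eqP => // deg_m'; rewrite mcoeffX.
  by case: eqP => // E; rewrite -E deg_m' eqxx in ndeg.
have lt_m : (mdeg m < n.+1)%N by rewrite deg_m.
rewrite (bigD1 (Sub m lt_m)) //= deg_m eqxx mcoeffX eqxx big1 ?addr0 // => m' ne.
case: eqP => // _; rewrite mcoeffX; case: eqP => // E; case/negP: ne.
by rewrite -val_eqE /= E.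
Qed.

(** At a monomial of degree [n] both sides count the pairs formed of a variable
    and a positive exponent at most that of this variable. *)
Lemma hsym_newton n : hsym n *+ n = \sum_(1 <= q < n.+1) hsym (n - q) * psum k S q.
Proof.
apply/mpolyP => m; rewrite mcoeffMn mcoeff_hsym raddf_sum /=.
have E q : (1 <= q < n.+1)%N -> (hsym (n - q) * psum k S q)@_m =
    ((mdeg m == n) * \sum_(i < k) (q <= m i))%:R.
  case/andP=> _ le_qn; rewrite mcoeff_mul_psum big_distrr natr_sum /= big_mkcond /=.
  apply: eq_bigr => i _; case: ifP => le_qm; last by rewrite muln0.
  rewrite muln1 mcoeff_hsym -(mdegB_U le_qm) -(eqn_add2r q) subnK //.
rewrite (eq_big_nat _ _ E) -natr_sum -big_distrr /=.
have [deg_m|] := eqVneq; last by rewrite mul0n mul0rn.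
rewrite mul1n exchange_big /= -deg_m mdegE; congr _%:R.
apply: eq_bigr => i _.
have le : (m i <= mdeg m)%N by rewrite mdegE (bigD1 i) //= leq_addr.
rewrite -mdegE (@big_cat_nat _ _ _ (m i).+1) //=.
rewrite (eq_big_nat _ _ (F2 := fun=> 1%N)); last by move=> q /andP[_]; rewrite ltnS => ->.
rewrite sum_nat_const_nat subn1 muln1 [X in (_ + X)%N]big_nat big1 ?addn0 //.
by move=> q /andP[lt _]; rewrite leqNgt lt.
Qed.

(** Burnside's lemma for words, one content at a time. *)
Lemma sum_fixsum n : \sum_(s : 'S_n) fixsum (fun i : 'I_k => 'X_i) s = hsym n *+ n`!.
Proof.
apply/mpolyP => m; rewrite raddf_sum mcoeffMn mcoeff_hsym /=.
under eq_bigr => s _ do rewrite mcoeff_fixsum.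
by rewrite -natr_sum card_fixed_words natrM mulr_natr.
Qed.

End CompleteSymmetric.

(** * Cauchy's identity and orthonormality *)

Section Cauchy.
Variables (N : nat) (R : numDomainType).
Implicit Types (b m : 'X_{1..N}).

Local Notation RN := {mpoly R[N]}.
Local Notation S := {mpoly RN[N]}.
Local Notation A := ('I_N * 'I_N)%type.

(** Two sets of variables are needed: [x] lives in the coefficients and [y] in the
    outer polynomials. The kernel is obtained from the complete symmetric
    polynomial in one variable for each pair [(i, j)], specialised at
    [x_i * y_j]. *)
Definition kvar (c : A) : S := ('X_c.1)%:MP * 'X_c.2.
Definition kmap : {mpoly R[#|{: A}|]} -> S :=
  mmap (@mpolyC N RN \o @mpolyC N R) (fun c => kvar (enum_val c)).
HB.instance Definition _ := GRing.RMorphism.copy kmap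
  (mmap (@mpolyC N RN \o @mpolyC N R) (fun c => kvar (enum_val c))).


(** The degree [n] part of the Cauchy kernel [prod_(i,j) 1 / (1 - x_i y_j)]. *)
Definition cauchy n : S := kmap (hsym _ R n).

Definition word_poly n (s : 'S_n) : RN := fixsum (fun i => 'X_i) s.

Lemma kmapX c : kmap 'X_c = kvar (enum_val c).
Proof. by rewrite /kmap mmapX mmap1U. Qed.

Lemma kmap_psum q : kmap (psum _ R q) = (psum N R q)%:MP * psum N RN q.
Proof.
rewrite rmorph_sum /=; under eq_bigr => c _ do rewrite rmorphXn /= kmapX.
have := reindex (@enum_val A predT) (P := predT) (F := fun c => kvar c ^+ q).
rewrite (eq_bigl predT) // => <-; last exact/onW_bij/enum_val_bij.
rewrite /psum raddf_sum big_distrlr pair_big /=; apply: eq_bigr => c _.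
by rewrite /kvar exprMn rmorphXn.
Qed.

Lemma kmap_fixsum n (s : 'S_n) :
  kmap (fixsum (fun i => 'X_i) s) = (word_poly s)%:MP * map_mpoly (@mpolyC N R) (word_poly s).
Proof.
rewrite !rmorph_fixsum /= -fixsum_pair /=.
rewrite (eq_fixsum (z' := fun c => kvar (enum_val c))); last exact: kmapX.
rewrite (fixsum_bij (e := @enum_val A predT) kvar); last exact: enum_val_bij.
by apply: eq_fixsum => c; rewrite /kvar map_mpolyX.
Qed.

Lemma cauchy_newton n :
  cauchy n *+ n = \sum_(1 <= q < n.+1) (psum N R q)%:MP * (cauchy (n - q) * psum N RN q).
Proof.
rewrite -rmorphMn hsym_newton rmorph_sum; apply: eq_bigr => q _.
by rewrite rmorphM /= kmap_psum mulrCA.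
Qed.

Lemma sum_word_poly n :
  \sum_(s : 'S_n) (word_poly s)%:MP * map_mpoly (@mpolyC N R) (word_poly s)
  = cauchy n *+ n`!.
Proof.
rewrite -rmorphMn -sum_fixsum rmorph_sum; apply: eq_bigr => s _.
exact: esym (kmap_fixsum s).
Qed.

Local Notation vdm := (alternant R (stair N)).
Local Notation vdm' := (alternant RN (stair N)).

(** Cauchy's identity [a_delta(x) a_delta(y) prod 1/(1 - x_i y_j) =
    sum_b a_b(x) y^b], read off at [y^b]. By induction on [n]: Newton's identity
    holds for the left side because power sums of the products [x_i y_j] are
    products of power sums, and for the right side by [alternant_newton]. *)
Lemma cauchy_alternant n b : mdeg b = (n + mdeg (stair N))%N ->
  vdm * (vdm' * cauchy n)@_b = alternant R b.
Proof.
elim/ltn_ind: n b => -[|n] IHn b deg_b.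
  have -> : cauchy 0 = 1.
    rewrite /cauchy; have -> : hsym #|{: A}| R 0 = 1; last exact: rmorph1.
    by apply/mpolyP => m; rewrite mcoeff_hsym mcoeff1 mdeg_eq0.
  rewrite mulr1 mcoeff_alternant.
  have [/injectiveP inj_b|ninj] := boolP (injectiveb b); last first.
    rewrite (noninj_alternant R ninj) big_pred0 ?mulr0 // => s.
    apply/negP => /eqP bE; case/negP: ninj; apply/injectiveP => i j.
    by rewrite -bE !mnmE => /val_inj/perm_inj.
  have [t bE] := inj_stairP inj_b deg_b.
  rewrite -mcoeff_alternant bE alternating_mcoeff; last exact: alternant_alternating.
  rewrite mcoeff_alternant_id ?mulr1; last exact: stair_inj.
  by rewrite alternant_perm -mul_mpolyC rmorph_sign mulrC.
apply: (@mpolyMn_inj _ _ n.+1) => //=.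
rewrite -(alternant_newton R deg_b) -mulrnAr -mcoeffMn -mulrnAr cauchy_newton.
rewrite mulr_sumr raddf_sum mulr_sumr /=; apply: eq_big_nat => q /andP[q_gt0 le_qn].
rewrite mulrCA mcoeffCM (mulrA vdm') mcoeff_mul_psum mulrCA mulr_sumr mulr_sumr.
apply: eq_bigr => j le_qb; rewrite mulrC; congr (_ * _).
apply: IHn; first by lia.
by have := mdegB_U le_qb; lia.
Qed.

(** Frobenius's formula for the value at [s] of the character attached to [b]. *)
Definition frob n (b : 'X_{1..N}) (s : 'S_n) : R := (vdm * word_poly s)@_b.

Lemma map_vdm : map_mpoly (@mpolyC N R) vdm = vdm'.
Proof.
rewrite rmorph_sum; apply: eq_bigr => s _.
by rewrite /= map_mpolyZ map_mpolyX /= (rmorph_sign (@mpolyC N R)).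
Qed.

(** The average over [s] of the products of two values is a coefficient of the
    Cauchy kernel times the Vandermonde products, i.e. of an alternant. *)
Lemma frob_dot n b b' : mdeg b = (n + mdeg (stair N))%N ->
  \sum_(s : 'S_n) frob b s * frob b' s = (alternant R b)@_b' *+ n`!.
Proof.
move=> deg_b; rewrite -mcoeffMn -(cauchy_alternant deg_b) -mulrnAr -mcoeffMn -mulrnAr.
rewrite -sum_word_poly mulr_sumr raddf_sum mulr_sumr raddf_sum /=.
apply: eq_bigr => s _; rewrite mulrCA mcoeffCM -map_vdm -rmorphM mcoeff_map_mpoly.
by rewrite [X in _ = X@__]mulrA [X in _ = X@__]mulrC mcoeffCM.
Qed.

End Cauchy.

(** * The irreducible characters of the symmetric group *)

Section PermutationCharacters.
Variables n k : nat.
Implicit Types (f g : {ffun 'I_n -> 'I_k}) (m : 'X_{1..k}).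
Local Notation G := [set: 'S_n].

Definition word_stab f := [set s : 'S_n | word_act f s == f].

Lemma word_stab_group_set f : group_set (word_stab f).
Proof.
apply/group_setP; split=> [|s t]; rewrite !inE ?word_act1 // => /eqP fs /eqP ft.
by rewrite word_actM ft fs.
Qed.
Canonical word_stab_group f := Group (word_stab_group_set f).

(** The permutation character on the words of content [m], which form a single
    orbit when there are any: inducing from a stabiliser shows at once that it is
    a character. *)
Definition permchar m : 'CF(G) :=
  if [pick f | content f == m] is Some f then 'Ind[G, word_stab_group f] 1 else 0.

Lemma permchar_char m : permchar m \is a character.
Proof.
rewrite /permchar; case: pickP => [f _|_]; last exact: rpred0.
by rewrite cfInd_char // cfun1_char.
Qed.

Lemma card_word_transporter f g : content f = content g ->
  #|[set s : 'S_n | word_act f s == g]| = #|word_stab f|.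
Proof.
move=> /esym/content_eqP[t ->].
rewrite -[RHS](card_imset _ (mulgI t)); apply: eq_card => s.
rewrite !inE; apply/eqP/imsetP => [fs|[u]]; last first.
  by rewrite inE => /eqP fu ->; rewrite word_actM fu.
exists (t^-1 * s)%g; last by rewrite mulKVg.
by rewrite inE word_actM fs -word_actM mulVg word_act1.
Qed.

Lemma permcharE m s :
  permchar m s = #|[set f | (word_act f s == f) && (content f == m)]|%:R.
Proof.
rewrite /permchar; case: pickP => [f /eqP cf|none]; last first.
  by rewrite cfunE eq_card0 // => f; rewrite inE none andbF.
rewrite cfIndE ?subsetT //; set c := #|_|.
have c_neq0 : (#|word_stab f|%:R : algC) != 0.
  by rewrite pnatr_eq0 -lt0n (cardG_gt0 (word_stab_group f)).
apply: (mulfI c_neq0); rewrite mulVKf //.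
transitivity (\sum_(y : 'S_n) ((word_act (word_act f y) s == word_act f y)%:R : algC)).
  apply: eq_big => [y|y _]; first by rewrite inE.
  rewrite cfun1E inE conjgE !word_actM; congr ((nat_of_bool _)%:R : algC).
  apply/eqP/eqP => [E|->]; last by rewrite -!word_actM mulVg word_act1.
  move/(congr1 (fun g => word_act g y)): E => /=.
  by rewrite -[X in X = _]word_actM mulgV word_act1.
rewrite (partition_big (word_act f) (fun g => content g == m)) /=; last first.
  by move=> y _; rewrite content_act cf.
rewrite -natrM mulnC /c -sum1_card big_distrl natr_sum /= [RHS]big_mkcond [LHS]big_mkcond /=.
apply: eq_bigr => g _; rewrite inE.
have [cg|_] := eqVneq (content g) m; last by rewrite andbF.
rewrite andbT mul1n -(@card_word_transporter f g) ?cf ?cg //.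
rewrite (eq_bigr (fun=> ((word_act g s == g)%:R : algC))); last by move=> y /eqP->.
rewrite sumr_const -sum1_card; case: (_ == g); rewrite ?mul0rn //.
by rewrite sum1_card; congr (_ *+ _); apply: eq_card => y; rewrite !inE.
Qed.

End PermutationCharacters.

Section FrobeniusCharacters.
Variables n N : nat.
Implicit Types b : 'X_{1..N}.
Local Notation G := [set: 'S_n].
Local Notation vdm := (alternant algC (stair N)).

(** Expanding the Vandermonde product in Frobenius's formula displays it as an
    integral combination of permutation characters. *)
Definition frobchar (b : 'X_{1..N}) : 'CF(G) :=
  \sum_(w : 'S_N | ((stair N)#w <= b)%MM) (-1) ^+ w *: permchar n (b - (stair N)#w)%MM.

Lemma frobcharE b s : frobchar b s = frob algC b s.
Proof.
rewrite /frob mulr_suml raddf_sum sum_cfunE big_mkcond /=; apply: eq_bigr => w _.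
rewrite -scalerAl mcoeffZ [X in _ = _ * X@__]mulrC mcoeffMX_le.
case: ifP => _; last by rewrite mulr0.
by rewrite cfunE permcharE /word_poly mcoeff_fixsum.
Qed.

Lemma frobchar_vchar b : frobchar b \in 'Z[irr G].
Proof.
apply: rpred_sum => w _; rewrite scaler_sign; case: ifP => _; rewrite ?rpredN;
by apply: char_vchar; exact: permchar_char.
Qed.

Lemma frob_int b (s : 'S_n) : frob algC b s \in Num.int.
Proof.
rewrite -frobcharE sum_cfunE; apply: rpred_sum => w _.
by rewrite cfunE rpredMsign permcharE rpred_nat.
Qed.

Lemma msym_word_poly (R : numDomainType) (s : 'S_n) (t : 'S_N) :
  msym t (word_poly N R s) = word_poly N R s.
Proof.
rewrite /word_poly rmorph_fixsum -[RHS](fixsum_bij (e := t)); last exact/injF_bij/perm_inj.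
by apply: eq_fixsum => i /=; rewrite /msym mmapX mmap1U.
Qed.

Lemma alternating_frob (R : numDomainType) (s : 'S_n) :
  alternating (alternant R (stair N) * word_poly N R s).
Proof.
by apply: alternatingM; [exact: alternant_alternating | move=> t; exact: msym_word_poly].
Qed.

Lemma frobchar_neq0 b : frobchar b != 0 ->
  injective b /\ mdeg b = (n + mdeg (stair N))%N.
Proof.
move=> nz; have [s nz_s] : exists s, frobchar b s != 0.
  apply/existsP; apply: contraNT nz; rewrite negb_exists => /forallP z.
  by apply/eqP/cfunP => s; rewrite cfunE; apply/eqP; rewrite -[_ == _]negbK z.
split.
  by apply: (alternating_neq0_inj (alternating_frob algC s)); rewrite frobcharE in nz_s.
have [w le_w nz_w] : exists2 w : 'S_N, ((stair N)#w <= b)%MM &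
    permchar n (b - (stair N)#w)%MM s != 0.
  apply/exists_inP; apply: contraNT nz_s; rewrite negb_exists_in => /forall_inP z.
  rewrite sum_cfunE big1 // => w /z; rewrite negbK cfunE => /eqP->.
  by rewrite mulr0.
move: nz_w; rewrite permcharE pnatr_eq0 cards_eq0 => /set0Pn[f].
rewrite inE => /andP[_ /eqP cf].
by rewrite -(submK le_w) mdegD -cf mdeg_content mdeg_mperm.
Qed.

Lemma frobchar_norm b : injective b -> mdeg b = (n + mdeg (stair N))%N ->
  '[frobchar b] = 1.
Proof.
move=> inj_b deg_b; rewrite cfdotE cardsT card_Sn.
have -> : \sum_(s in G) frobchar b s * (frobchar b s)^* =
          \sum_(s : 'S_n) frob algC b s * frob algC b s.
  apply: eq_big => [s|s _]; first by rewrite inE.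
  by rewrite frobcharE conj_intr // frob_int.
rewrite frob_dot // mcoeff_alternant_id // mulVf // pnatr_eq0.
by rewrite -lt0n fact_gt0.
Qed.

End FrobeniusCharacters.

Section Completeness.
Variable n : nat.
Local Notation G := [set: 'S_n].

(** Let [Q] be the sum of the [p_s], weighted by the conjugates of the values of an
    irreducible character [chi]. Since polynomials form a domain, [a_delta * Q] is
    nonzero as soon as [Q] is, and each of its coefficients is a scalar product
    with some [frobchar b]. And [Q] is nonzero at the product of all variables: a
    word with distinct letters is fixed by the identity alone, so that only
    [chi 1] counts there. *)
Lemma frobchar_complete (i : Iirr G) : exists b : 'X_{1..n}, '[frobchar n b, 'chi_i] != 0.
Proof.
set chi := 'chi_i.
pose Q : {mpoly algC[n]} := \sum_(s : 'S_n) (chi s)^* *: word_poly n algC s.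
have dotE b : '[frobchar n b, chi] = n`!%:R^-1 * (alternant algC (stair n) * Q)@_b.
  rewrite cfdotE cardsT card_Sn [in RHS]mulr_sumr raddf_sum /=; congr (_ * _).
  apply: eq_big => [s|s _]; first by rewrite inE.
  by rewrite -scalerAr mcoeffZ frobcharE mulrC.
have Q_neq0 : Q != 0.
  apply: contraTneq isT => /(congr1 (mcoeff [multinom 1%N | _ < n])).
  rewrite mcoeff0 raddf_sum /=.
  have content1 (f : {ffun 'I_n -> 'I_n}) :
      content f = [multinom 1%N | _ < n] -> injective f.
    move=> cf j l fjl; apply/eqP/negPn/negP => jl.
    move/mnmP/(_ (f l)): cf; rewrite contentE mnmE (bigD1 j) //= fjl eqxx.
    by rewrite (bigD1 l) /= ?eqxx 1?eq_sym.
  rewrite (bigD1 1%g) //= big1 ?addr0 => [|s ns]; last first.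
    rewrite mcoeffZ mcoeff_fixsum eq_card0 ?mulr0 // => f; rewrite inE.
    apply/negP => /andP[/eqP/ffunP fs /eqP/content1 inj_f]; case/eqP: ns.
    by apply/permP => j; rewrite perm1; apply: inj_f; rewrite -[RHS]fs ffunE.
  rewrite mcoeffZ mcoeff_fixsum => /eqP; rewrite mulf_eq0 conjC_eq0 /chi (negbTE (irr1_neq0 i)) /=.
  rewrite pnatr_eq0 cards_eq0 => /eqP/setP/(_ [ffun j => j]).
  rewrite !inE word_act1 eqxx /= => /negbT/eqP; case; apply/mnmP => j.
  rewrite contentE mnmE (bigD1 j) //= ffunE eqxx.
  by rewrite big1 ?addn0 // => l /negbTE lj; rewrite ffunE lj.
have vdm_neq0 : alternant algC (stair n) != 0.
  apply: contraTneq isT => /(congr1 (mcoeff (stair n)))/eqP.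
  by rewrite mcoeff_alternant_id ?mcoeff0 ?oner_eq0 //; exact: stair_inj.
exists (mlead (alternant algC (stair n) * Q)); rewrite dotE mulf_neq0 //.
  by rewrite invr_eq0 pnatr_eq0 -lt0n fact_gt0.
by rewrite mleadc_eq0 mulf_neq0.
Qed.

(** A generalised character of norm 1 is irreducible up to sign, and by
    [frobchar_complete] every irreducible character meets one of them. *)
Lemma irr_frobchar (chi : 'CF(G)) : chi \in irr G ->
  exists (b : 'X_{1..n}) (e : bool),
    [/\ injective b, mdeg b = (n + mdeg (stair n))%N &
        forall s, chi s = (-1) ^+ e * frob algC b s].
Proof.
case/irrP => i ->; have [b nz] := frobchar_complete i.
have [|inj_b deg_b] := @frobchar_neq0 n n b.
  by apply: contraNneq nz => ->; rewrite cfdot0l.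
have [e [j bE]] := vchar_norm1P (frobchar_vchar n b) (frobchar_norm inj_b deg_b).
exists b, e; split=> // s; rewrite -frobcharE bE cfunE mulrA -signr_addb addbb mul1r.
move: nz; rewrite bE cfdotZl cfdot_irr; have [-> //|_] := eqVneq j i.
by rewrite mulr0 eqxx.
Qed.

End Completeness.

(** * Degrees and their prime parts *)

Section Degrees.
Variables (N : nat) (R : numDomainType).
Implicit Types b m : 'X_{1..N}.

Lemma word_poly1 n : word_poly N R (1 : 'S_n) = psum N R 1 ^+ n.
Proof.
rewrite /psum -[n in RHS]card_ord -prodr_const bigA_distr_bigA.
apply: eq_bigl => f; apply/forallP => k; by rewrite perm1.
Qed.

(** The multinomial theorem. *)
Lemma mcoeff_psum1X n m : mdeg m = n ->
  (psum N R 1 ^+ n)@_m * (\prod_i (m i)`!)%:R = n`!%:R.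
Proof.
elim: n m => [|n IHn] m deg_m.
  rewrite expr0 mcoeff1; move/eqP: deg_m; rewrite mdeg_eq0 => /eqP->.
  by rewrite eqxx mul1r big1 // => i _; rewrite mnm0E.
rewrite exprSr mcoeff_mul_psum mulr_suml.
rewrite (eq_bigr (fun i => (m i * n`!)%:R)) => [|i mi_gt0]; last first.
  rewrite [(\prod_j _)%N](bigD1 i) //=.
  have deg_m' : mdeg (m - U_(i) *+ 1) = n by have := mdegB_U mi_gt0; lia.
  rewrite [RHS]natrM -(IHn _ deg_m') mulrCA -natrM; congr (_ * _%:R).
  rewrite [in RHS](bigD1 i) //= mnmBE mulUE eqxx mulnA subn1; congr (_ * _)%N.
    by rewrite -[in LHS](prednK mi_gt0) factS prednK.
  by apply: eq_bigr => j ji; rewrite mnmBE mulUE eq_sym (negbTE ji) subn0.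
rewrite -natr_sum -big_distrl /=; congr (_%:R); rewrite factS; congr (_ * _)%N.
rewrite -deg_m mdegE big_mkcond; apply: eq_bigr => i _.
by case: ltnP; rewrite ?leqn0 // => /eqP.
Qed.

Definition ffact_poly j : {poly R} := \prod_(k < j) ('X - k%:R%:P).

Lemma horner_ffact_poly j x : (ffact_poly j).[x%:R] = (x ^_ j)%:R.
Proof.
elim: j => [|j IHj]; first by rewrite /ffact_poly big_ord0 hornerC ffactn0.
rewrite /ffact_poly big_ord_recr /= hornerM IHj hornerXsubC ffactnSr natrM.
have [le_jx|lt_xj] := leqP j x; first by rewrite natrB.
by rewrite ffact_small // !mul0r.
Qed.

(** Falling factorials are monic of the right degrees, so a unitriangular change
    of basis turns their determinant into Vandermonde's. *)
Lemma det_ffact b :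
  \det (\matrix_(i < N, j < N) ((b i ^_ j)%:R : R)) =
  \prod_(i < N) \prod_(j < N | (i < j)%N) ((b j)%:R - (b i)%:R).
Proof.
pose V := Vandermonde N (\row_(j < N) ((b j)%:R : R)).
pose C := \matrix_(j < N, k < N) (ffact_poly j)`_k.
have size_f j : size (ffact_poly j) = j.+1 by rewrite size_prod_XsubC /index_enum -enumT size_enum_ord.
have monic_f j : ffact_poly j \is monic by apply: monic_prod_XsubC.
have -> : \matrix_(i < N, j < N) ((b i ^_ j)%:R : R) = V^T *m C^T.
  apply/matrixP => i j; rewrite !mxE -horner_ffact_poly.
  rewrite (@horner_coef_wide _ N) ?size_f //.
  by apply: eq_bigr => k _; rewrite !mxE mulrC.
rewrite det_mulmx !det_tr det_Vandermonde (@det_trig _ _ C).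
  rewrite [X in _ * X]big1 ?mulr1 => [|j _]; last first.
    by have := monicP (monic_f j); rewrite mxE lead_coefE size_f.
  by apply: eq_bigr => i _; apply: eq_bigr => j _; rewrite !mxE.
by apply/is_trig_mxP => j k lt_jk; rewrite mxE nth_default // size_f.
Qed.

(** Frobenius's degree formula: the Leibniz expansion of the determinant of the
    falling factorials matches that of the Vandermonde product, term by term, as
    [b^_w / b! = 1 / (b - w)!]. *)
Lemma frob1_degree n b : mdeg b = (n + mdeg (stair N))%N ->
  frob R b (1 : 'S_n) * (\prod_i (b i)`!)%:R =
  n`!%:R * \prod_(i < N) \prod_(j < N | (i < j)%N) ((b j)%:R - (b i)%:R).
Proof.
move=> deg_b; rewrite -det_ffact /determinant /frob word_poly1.
rewrite !mulr_suml raddf_sum mulr_sumr mulr_suml /=; apply: eq_bigr => w _.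
rewrite -scalerAl mcoeffZ mulrCA -mulrA; congr (_ * _).
rewrite [X in X@__]mulrC mcoeffMX_le.
under [in RHS]eq_bigr => i _ do rewrite mxE.
case: ifPn => [le_w|]; last first.
  rewrite mul0r negb_forall => /existsP[i]; rewrite mnmE -ltnNge mnmE => lt_i.
  by rewrite (bigD1 i) //= ffact_small // mul0r mulr0.
have deg_m : mdeg (b - (stair N)#w) = n.
  apply/eqP; rewrite -(eqn_add2r (mdeg (stair N))) -deg_b.
  by rewrite -{1}(mdeg_mperm (stair N) w) -mdegD submK.
rewrite -(mcoeff_psum1X deg_m) -mulrA; congr (_ * _).
rewrite -natr_prod -natrM -big_split; congr (_%:R); apply: eq_bigr => i _ /=.
have := mnm_lepP le_w i; rewrite mnmBE !mnmE => le_i.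
by rewrite mulnC ffact_fact.
Qed.

End Degrees.

Section Valuation.
Variables (N n p : nat).
Hypothesis p_prime : prime p.
Implicit Types b : 'X_{1..N}.

Lemma logn_fact_bound x L : (x < L)%N -> logn p x`! = (\sum_(1 <= k < L) x %/ p ^ k)%N.
Proof.
move=> lt_xL; rewrite logn_fact // [RHS](@big_cat_nat _ _ _ x.+1) //=.
rewrite [X in _ = (_ + X)%N]big_nat [X in _ = (_ + X)%N]big1 ?addn0 // => k /andP[lt_xk _].
by rewrite divn_small // (ltn_trans lt_xk) // ltn_expl // prime_gt1.
Qed.

Lemma logn_count_bound x L : (0 < x)%N -> (x < L)%N ->
  logn p x = (\sum_(1 <= k < L) (p ^ k %| x))%N.
Proof.
move=> x_gt0 lt_xL; rewrite logn_count_dvd // [RHS](@big_cat_nat _ _ _ x) //=; last exact: ltnW.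
rewrite [X in _ = (_ + X)%N]big_nat [X in _ = (_ + X)%N]big1 ?addn0 // => k /andP[le_xk _].
apply/eqP; rewrite eqb0; apply: contraL (ltn_expl k (prime_gt1 p_prime)) => /(dvdn_leq x_gt0) le.
by rewrite -leqNgt (leq_trans le).
Qed.

(** Legendre's formula turns the factorials [b_i!] into the quotients
    [b_i %/ p ^ k], and the differences [b_j - b_i] into the congruent pairs modulo
    [p ^ k]; by [weightE] what remains for each [k] is the weight. *)
Lemma logn_degree b d : injective b -> mdeg b = (n + mdeg (stair N))%N ->
    `|frob algC b (1 : 'S_n)| = d%:R ->
  (logn p d + \sum_(1 <= k < (mdeg b).+1) weight (p ^ k) b = logn p n`!)%N.
Proof.
move=> inj_b deg_b dE.
have lt_b i : (b i < (mdeg b).+1)%N by rewrite ltnS mdegE (bigD1 i) //= leq_addr.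
pose dist (i j : 'I_N) := (b j - b i + (b i - b j))%N.
have dist_gt0 (i j : 'I_N) : (i < j)%N -> (0 < dist i j)%N.
  move=> lt_ij; have : b i != b j by apply: contraTneq lt_ij => /inj_b->; rewrite ltnn.
  by rewrite /dist; case: ltngtP => //; lia.
have E : (d * \prod_i (b i)`! = n`! * \prod_(i < N) \prod_(j < N | (i < j)%N) dist i j)%N.
  apply/eqP; rewrite -(eqr_nat algC) !natrM -dE -[(\prod_i (b i)`!)%:R]ger0_norm ?ler0n //.
  rewrite -normrM frob1_degree // normrM normr_nat normr_prod natr_prod.
  apply/eqP; congr (_ * _); apply: eq_bigr => i _; rewrite normr_prod natr_prod.
  apply: eq_bigr => j _; rewrite /dist; have [le|/ltnW le] := leqP (b i) (b j).
    by rewrite -natrB // normr_nat (eqP (le : b i - b j == 0)%N) addn0.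
  by rewrite distrC -natrB // normr_nat (eqP (le : b j - b i == 0)%N) add0n.
have prod_gt0 : (0 < \prod_(i < N) \prod_(j < N | (i < j)%N) dist i j)%N.
  by rewrite prodn_gt0 // => i; rewrite prodn_cond_gt0 // => j; apply: dist_gt0.
have fact_prod_gt0 : (0 < \prod_i (b i)`!)%N by rewrite prodn_gt0 // => i; rewrite fact_gt0.
have d_gt0 : (0 < d)%N.
  by move: (muln_gt0 d (\prod_i (b i)`!)); rewrite E muln_gt0 fact_gt0 prod_gt0 => /esym/andP[].
have logn_prod (I : finType) (P : pred I) (F : I -> nat) :
    (forall i, P i -> 0 < F i)%N -> logn p (\prod_(i | P i) F i) = (\sum_(i | P i) logn p (F i))%N.
  move=> F_gt0; suff [] : (0 < \prod_(i | P i) F i)%N /\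
      logn p (\prod_(i | P i) F i) = (\sum_(i | P i) logn p (F i))%N by [].
  elim/big_rec2: _ => [|i x y Pi [y_gt0 yE]]; first by rewrite logn1.
  by rewrite muln_gt0 F_gt0 // lognM ?F_gt0 // yE.
have := congr1 (logn p) E; rewrite !lognM ?fact_gt0 // !logn_prod; first last.
- by move=> i _; rewrite fact_gt0.
- by move=> i _; rewrite prodn_cond_gt0 // => j; apply: dist_gt0.
rewrite (eq_bigr (fun i => \sum_(1 <= k < (mdeg b).+1) b i %/ p ^ k)%N); last first.
  by move=> i _; apply: logn_fact_bound.
rewrite exchange_big /=.
have -> : (\sum_(i < N) logn p (\prod_(j < N | (i < j)%N) dist i j) =
  \sum_(1 <= k < (mdeg b).+1) \sum_(i < N) \sum_(j < N | (i < j)%N) (b i == b j %[mod p ^ k]))%N.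
  rewrite [RHS]exchange_big; apply: eq_bigr => i _ /=.
  rewrite logn_prod; last exact: dist_gt0.
  rewrite [RHS]exchange_big; apply: eq_bigr => j lt_ij /=.
  rewrite (@logn_count_bound _ (mdeg b).+1) ?dist_gt0 //; last first.
    by rewrite /dist; have := lt_b i; have := lt_b j; lia.
  apply: eq_bigr => k _; congr nat_of_bool; rewrite /dist.
  have [le|/ltnW le] := leqP (b i) (b j).
    by rewrite (eqP (le : b i - b j == 0)%N) addn0 eq_sym eqn_mod_dvd.
  by rewrite (eqP (le : b j - b i == 0)%N) add0n eqn_mod_dvd.
rewrite (eq_bigr (fun k => weight (p ^ k) b + \sum_(i < N) \sum_(j < N | (i < j)%N)
   (b i == b j %[mod p ^ k]))%N); last first.
  by move=> k _; rewrite weightE // expn_gt0 prime_gt0.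
by rewrite big_split addnA => /addIn.
Qed.

End Valuation.

(** * Permutations of given cycle type *)

Section CycleTypes.

Lemma block_inj m n (s : 'S_m) (t : 'S_n) :
  injective (fun i : 'I_(m + n) =>
    match split i with inl j => lshift n (s j) | inr j => rshift m (t j) end).
Proof.
move=> i j; rewrite -(splitK i) -(splitK j); rewrite !unsplitK.
case: (split i) => x; case: (split j) => y /=.
- by move/(@lshift_inj m n)/perm_inj->.
- by move/eqP; rewrite eq_lrshift.
- by move/eqP; rewrite eq_rlshift.
- by move/(@rshift_inj m n)/perm_inj->.
Qed.

Definition block_perm m n (s : 'S_m) (t : 'S_n) : 'S_(m + n) := perm (@block_inj m n s t).

Lemma block_permL m n (s : 'S_m) (t : 'S_n) i : block_perm s t (lshift n i) = lshift n (s i).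
Proof. by rewrite permE -[lshift n i]/(unsplit (inl i)) unsplitK. Qed.

Lemma block_permR m n (s : 'S_m) (t : 'S_n) i : block_perm s t (rshift m i) = rshift m (t i).
Proof. by rewrite permE -[rshift m i]/(unsplit (inr i)) unsplitK. Qed.

Lemma block_permX m n (s : 'S_m) (t : 'S_n) e :
  (s ^+ e = 1 -> t ^+ e = 1 -> block_perm s t ^+ e = 1)%g.
Proof.
move=> se te; apply/permP => i; rewrite perm1 permX -(splitK i).
case: (split i) => j /=.
  have -> : iter e (block_perm s t) (lshift n j) = lshift n ((s ^+ e)%g j).
    by rewrite permX; elim: e {se te} => //= e ->; rewrite block_permL.
  by rewrite se perm1.
have -> : iter e (block_perm s t) (rshift m j) = rshift m ((t ^+ e)%g j).
  by rewrite permX; elim: e {se te} => //= e ->; rewrite block_permR.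
by rewrite te perm1.
Qed.

Lemma fixsum_block (A : finType) (S : comNzRingType) (z : A -> S) m n
    (s : 'S_m) (t : 'S_n) :
  fixsum z (block_perm s t) = fixsum z s * fixsum z t.
Proof.
rewrite /fixsum big_distrlr pair_big /=.
pose glue (u : {ffun 'I_m -> A} * {ffun 'I_n -> A}) : {ffun 'I_(m + n) -> A} :=
  [ffun i => match split i with inl j => u.1 j | inr j => u.2 j end].
have glueL u j : glue u (lshift n j) = u.1 j.
  by rewrite ffunE -[lshift n j]/(unsplit (inl j)) unsplitK.
have glueR u j : glue u (rshift m j) = u.2 j.
  by rewrite ffunE -[rshift m j]/(unsplit (inr j)) unsplitK.
rewrite (reindex glue) /=; last first.
  exists (fun h : {ffun 'I_(m + n) -> A} =>
      ([ffun j => h (lshift n j)], [ffun j => h (rshift m j)])).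
    by case=> f g _; congr (_, _); apply/ffunP => j; rewrite ffunE (glueL, glueR).
  move=> h _; apply/ffunP => i; rewrite -(splitK i).
  by case: (split i) => j /=; rewrite ?glueL ?glueR ffunE.
apply: eq_big => [u|u _]; last first.
  rewrite big_split_ord /=; congr (_ * _); apply: eq_bigr => j _.
    by rewrite glueL.
  by rewrite glueR.
apply/forallP/andP => [h|[/forallP h1 /forallP h2] i].
  split; apply/forallP => j.
    by have := h (lshift n j); rewrite block_permL !glueL.
  by have := h (rshift m j); rewrite block_permR !glueR.
rewrite -(splitK i); case: (split i) => j /=.
  by rewrite block_permL !glueL.
by rewrite block_permR !glueR.
Qed.

Definition cycle_perm q : 'S_q := perm (can_inj (@ordSK q)).

Lemma cycle_permX q e : (q %| e)%N -> (cycle_perm q ^+ e = 1)%g.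
Proof.
move=> q_e; apply/permP => i; rewrite perm1 permX; apply: val_inj.
have -> : val (iter e (cycle_perm q) i) = ((i + e) %% q)%N.
  elim: e {q_e} => [|e IHe] /=; first by rewrite addn0 modn_small.
  by rewrite permE /= IHe -addn1 modnDml addn1 addnS.
by rewrite -modnDmr (eqP q_e) addn0 modn_small.
Qed.

Lemma fixsum_cycle (A : finType) (S : comNzRingType) (z : A -> S) q :
  (0 < q)%N -> fixsum z (cycle_perm q) = \sum_a z a ^+ q.
Proof.
case: q => // q _; rewrite /fixsum.
rewrite (reindex (fun a => [ffun _ : 'I_q.+1 => a])) /=; last first.
  exists (fun f : {ffun 'I_q.+1 -> A} => f ord0) => [a _|f]; first by rewrite ffunE.
  rewrite inE => /forallP fs; apply/ffunP => -[k lt_k]; rewrite ffunE.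
  elim: k lt_k => [|k IHk] lt_k; first by congr (f _); apply: val_inj.
  rewrite (IHk (ltnW lt_k)) -(eqP (fs _)); congr (f _); apply: val_inj.
  by rewrite permE /= modn_small.
rewrite (eq_bigl predT) => [|a]; last by apply/forallP => k; rewrite !ffunE.
apply: eq_bigr => a _; under eq_bigr => k _ do rewrite ffunE.
by rewrite prodr_const card_ord.
Qed.

(** The power sums of an arbitrary family [z] express the cycle type [l]; the
    second property bounds the order. *)
Lemma exists_cycle_type n (l : seq nat) :
    sumn l = n -> (forall q, q \in l -> 0 < q)%N ->
  exists s : 'S_n,
    (forall (A : finType) (S : comNzRingType) (z : A -> S),
       fixsum z s = \prod_(q <- l) \sum_a z a ^+ q) /\
    (forall e, (forall q, q \in l -> q %| e)%N -> (s ^+ e = 1)%g).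
Proof.
elim: l n => [|q l IHl] n /= <- l_gt0.
  exists 1%g; split=> [A S z|e _]; last by rewrite expg1n.
  rewrite big_nil /fixsum.
  have f0 : {ffun 'I_0 -> A} by apply: finfun => -[].
  rewrite (big_pred1 f0) ?big_ord0 // => f.
  have -> : f = f0 by apply/ffunP => -[].
  by rewrite /= eqxx; apply/forallP => -[].
have [|s [sE sX]] := IHl _ (erefl (sumn l)).
  by move=> r rl; apply: l_gt0; rewrite inE rl orbT.
exists (block_perm (cycle_perm q) s); split=> [A S z|e l_e].
  rewrite fixsum_block fixsum_cycle ?sE ?big_cons //.
  by rewrite l_gt0 ?mem_head.
apply: block_permX.
  by rewrite cycle_permX // l_e ?mem_head.
by apply: sX => r rl; rewrite l_e // inE rl orbT.
Qed.

End CycleTypes.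

(** * Values at elements of prime power order *)

Section Peel.
Variables (N : nat) (R : numDomainType).
Implicit Types b : 'X_{1..N}.
Local Notation vdm := (alternant R (stair N)).

Lemma alternating_mul_psums P (s : seq nat) :
  alternating P -> alternating (P * \prod_(q <- s) psum N R q).
Proof.
move=> altP; apply: alternatingM => // t; rewrite rmorph_prod /=.
by apply: eq_bigr => q _; rewrite msym_psum.
Qed.

(** A nonzero coefficient is reached by at least one sequence of hook removals,
    which ends in some [c]. *)
Lemma mul_psums_path q P (s : seq nat) b :
    (forall l, l \in s -> q %| l)%N -> (P * \prod_(l <- s) psum N R l)@_b != 0 ->
  exists c, [/\ P@_c != 0, forall i, b i = c i %[mod q] & mdeg b = (mdeg c + sumn s)%N].
Proof.
elim: s b => [|l s IHs] b q_s.
  by rewrite big_nil mulr1 => nz; exists b; rewrite addn0.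
rewrite big_cons mulrCA mulrC mcoeff_mul_psum => nz.
have [i le_i nz_i] : exists2 i, (l <= b i)%N &
    (P * \prod_(l <- s) psum N R l)@_(b - U_(i) *+ l) != 0.
  apply/exists_inP; apply: contraNT nz; rewrite negb_exists_in => /forall_inP z.
  by rewrite big1 // => i /z; rewrite negbK => /eqP.
have [|c [nz_c bc deg_b]] := IHs _ _ nz_i.
  by move=> r rs; apply: q_s; rewrite inE rs orbT.
exists c; split=> // [j|]; last first.
  by rewrite -(mdegB_U le_i) deg_b /=; lia.
rewrite -bc mnmBE mulUE; case: eqP => [<-|_]; last by rewrite subn0.
have /dvdnP[r lE] := q_s l (mem_head _ _).
by rewrite -[in LHS](subnK le_i) {2}lE addnC modnMDl.
Qed.

(** Removing first the hooks of length [l] divisible by [q], each of them lowers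
    the weight by [l / q]; what is left is still a natural number. *)
Lemma weight_lower_bound q (s : seq nat) b : (0 < q)%N ->
  (vdm * \prod_(l <- s) psum N R l)@_b != 0 ->
  (\sum_(l <- s | q %| l) l <= q * weight q b)%N.
Proof.
move=> q_gt0 nz.
have inj_b : injective b.
  apply: alternating_neq0_inj nz; apply: alternating_mul_psums.
  exact: alternant_alternating.
move: nz; rewrite (bigID (fun l => q %| l)%N) /= mulrCA mulrC -[X in _ * X]big_filter.
rewrite -[X in _ * X * _]big_filter => nz.
have [|c [nz_c bc deg_b]] := mul_psums_path (q := q) _ nz.
  by move=> l; rewrite mem_filter => /andP[].
have inj_c : injective c.
  apply: alternating_neq0_inj nz_c; apply: alternating_mul_psums.
  exact: alternant_alternating.
have := weight_congr q_gt0 inj_b inj_c bc.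
rewrite deg_b sumnE big_filter; lia.
Qed.

(** Strip all hooks of length [p ^ K], then from the core all those of length
    [p ^ K.-1], and so on down to single cells. At each level
    [mcoeff_mul_psum_core] excludes cancellation. After the level [k] no weight
    remains for [p ^ k], so that the lengths removed so far, all divisible by
    [p ^ k], exhaust it. *)
Lemma peel_prime_powers p K b : prime p -> injective b ->
  exists s : seq nat,
    [/\ forall l, l \in s -> exists2 j, (j <= K)%N & l = (p ^ j)%N,
        (vdm * \prod_(l <- s) psum N R l)@_b != 0 &
        forall k, (k <= K)%N -> (\sum_(l <- s | p ^ k %| l) l = p ^ k * weight (p ^ k) b)%N].
Proof.
move=> p_pr; have pX_gt0 k : (0 < p ^ k)%N by rewrite expn_gt0 prime_gt0.
have nseq_psum q w : \prod_(l <- nseq w q) psum N R l = psum N R q ^+ w.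
  by rewrite big_nseq -Monoid.iteropE.
have nseq_sum q w (P : pred nat) : P q -> (\sum_(l <- nseq w q | P l) l = q * w)%N.
  by move=> Pq; rewrite -big_filter filter_nseq Pq mul1n big_nseq iter_addn_0.
elim: K b => [|K IHK] b inj_b.
  exists (nseq (weight 1 b) 1%N); split.
  - by move=> l /nseqP[-> _]; exists 0%N.
  - rewrite nseq_psum; have [] := mcoeff_mul_psum_core (P := vdm) (isT : 0 < 1)%N inj_b.
      exact: alternant_alternating.
    move=> c c_gt0 ->; have [t ->] := core1_stair inj_b.
    rewrite alternating_mcoeff; last exact: alternant_alternating.
    rewrite mcoeff_alternant_id ?mulr1; last exact: stair_inj.
    by rewrite mulf_neq0 ?signr_eq0 // pnatr_eq0 -lt0n.
  - by move=> k; rewrite leqn0 => /eqP->; rewrite expn0 nseq_sum.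
set q := (p ^ K.+1)%N; have q_gt0 : (0 < q)%N := pX_gt0 _.
have inj_c := core_inj q_gt0 inj_b.
have [s [s_pow s_nz s_sum]] := IHK _ inj_c.
exists (nseq (weight q b) q ++ s); split.
- move=> l; rewrite mem_cat => /orP[/nseqP[-> _]|/s_pow[j le_jK ->]].
    by exists K.+1.
  by exists j; rewrite // ltnW.
- rewrite big_cat /= nseq_psum [X in _ * X]mulrC mulrA.
  have [|c c_gt0 ->] := mcoeff_mul_psum_core (P := vdm * \prod_(l <- s) psum N R l) q_gt0 inj_b.
    by apply: alternating_mul_psums; exact: alternant_alternating.
  by rewrite mulf_neq0 // pnatr_eq0 -lt0n.
move=> k; rewrite leq_eqVlt => /predU1P[->|]; rewrite big_cat /=.
  rewrite nseq_sum ?dvdnn // [X in (_ + X)%N]big1_seq ?addn0 // => l /andP[q_l /s_pow[j le_jK lE]].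
  by move: q_l; rewrite lE dvdn_Pexp2l ?prime_gt1 // leqNgt ltnS le_jK.
rewrite ltnS => le_kK; rewrite nseq_sum ?s_sum //; last first.
  by rewrite dvdn_exp2l // ltnW.
have bc i : b i = core q b i %[mod p ^ k].
  have dv : (p ^ k %| q)%N by rewrite dvdn_exp2l // ltnW.
  by rewrite -(modn_dvdm _ dv) -[RHS](modn_dvdm _ dv) core_mod.
have := weight_congr (pX_gt0 k) inj_b inj_c bc.
rewrite (mdeg_core q_gt0 inj_b); lia.
Qed.

End Peel.

Section PrimeParts.
Variables (n : nat) (chi psi : 'CF([set: 'S_n])).
Hypotheses (irr_chi : chi \in irr [set: 'S_n]) (irr_psi : psi \in irr [set: 'S_n]).

Lemma frob_cycle_type N (b : 'X_{1..N}) (s : 'S_n) (l : seq nat) :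
  (forall (A : finType) (S : comNzRingType) (z : A -> S),
     fixsum z s = \prod_(q <- l) \sum_a z a ^+ q) ->
  frob algC b s = (alternant algC (stair N) * \prod_(q <- l) psum N algC q)@_b.
Proof. by move=> sE; rewrite /frob /word_poly sE. Qed.

(** The hook lengths stripped from [psi] are the cycle type of a [p]-element [x]
    with [psi x != 0], hence [chi x != 0], which bounds the weights of [psi] by
    those of [chi]. *)
Lemma logn_degree_le p dchi dpsi : prime p ->
    Van_pow chi \subset Van_pow psi -> chi 1%g = dchi%:R -> psi 1%g = dpsi%:R ->
  (logn p dchi <= logn p dpsi)%N.
Proof.
move=> p_pr sub_van chi1 psi1.
have [b [e [inj_b deg_b psiE]]] := irr_frobchar irr_psi.
have [b' [e' [inj_b' deg_b' chiE]]] := irr_frobchar irr_chi.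
have psi_d : `|frob algC b (1 : 'S_n)| = dpsi%:R.
  by rewrite -psi1 -[psi 1%g]ger0_norm ?psi1 ?ler0n // -psi1 psiE normrMsign.
have chi_d : `|frob algC b' (1 : 'S_n)| = dchi%:R.
  by rewrite -chi1 -[chi 1%g]ger0_norm ?chi1 ?ler0n // -chi1 chiE normrMsign.
have := logn_degree p_pr inj_b deg_b psi_d.
rewrite -(logn_degree p_pr inj_b' deg_b' chi_d) deg_b -deg_b'.
set K := mdeg b'; have [s [s_pow s_nz s_sum]] := peel_prime_powers algC K p_pr inj_b.
have sum_s : sumn s = n.
  have := s_sum 0%N isT; rewrite expn0 mul1n => E.
  apply/eqP; rewrite -(eqn_add2r (mdeg (stair n))) -deg_b (mdeg_weight1 inj_b) -E.
  by rewrite sumnE; apply/eqP; congr (_ + _)%N; apply: eq_bigl => l; rewrite dvd1n.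
have [|x [xE xX]] := exists_cycle_type sum_s.
  by move=> q /s_pow[j _ ->]; rewrite expn_gt0 prime_gt0.
have x_pgroup : p_group <[x]>%g.
  apply: (@pgroup_p _ p); rewrite /pgroup -orderE.
  apply: (@pnat_dvd _ (p ^ K)); last by rewrite pnatX pnat_id.
  rewrite order_dvdn; apply/eqP/xX => l /s_pow[j le_jK ->].
  exact: dvdn_exp2l.
have psi_x : psi x != 0.
  by rewrite psiE mulf_neq0 ?signr_eq0 // (frob_cycle_type b xE).
have chi_x : chi x != 0.
  apply: contraNneq psi_x => chi_x0; have /(subsetP sub_van) : x \in Van_pow chi.
    by rewrite !inE chi_x0 eqxx.
  by rewrite !inE => /andP[].
have frob_x : (alternant algC (stair n) * \prod_(q <- s) psum n algC q)@_b' != 0.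
  by move: chi_x; rewrite chiE (frob_cycle_type b' xE) mulf_eq0 negb_or => /andP[].
suff le_w : (\sum_(1 <= k < K.+1) weight (p ^ k) b <=
             \sum_(1 <= k < K.+1) weight (p ^ k) b')%N by lia.
rewrite big_nat [leqRHS]big_nat; apply: leq_sum => k /andP[_ le_kK].
have pk_gt0 : (0 < p ^ k)%N by rewrite expn_gt0 prime_gt0.
by rewrite -(leq_pmul2l pk_gt0) -s_sum // (weight_lower_bound pk_gt0 frob_x).
Qed.

End PrimeParts.

(** Comparing all prime parts, [chi 1] even divides [psi 1]. *)
Lemma irr1_le_Van_pow n (chi psi : 'CF([set: 'S_n])) :
    chi \in irr [set: 'S_n] -> psi \in irr [set: 'S_n] ->
  Van_pow chi \subset Van_pow psi -> chi 1%g <= psi 1%g.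
Proof.
move=> irr_chi irr_psi sub_van.
have degree_nat phi : phi \in irr [set: 'S_n] -> exists2 d, phi 1%g = d%:R & (0 < d)%N.
  case/irrP => i ->; have /natrP[d dE] := Cnat_irr1 i.
  by exists d; rewrite // -(ltr0n algC) -dE irr1_gt0.
have [dchi chi1 dchi_gt0] := degree_nat _ irr_chi.
have [dpsi psi1 dpsi_gt0] := degree_nat _ irr_psi.
rewrite chi1 psi1 ler_nat; apply: dvdn_leq => //.
apply/dvdn_partP => // p; rewrite mem_primes => /and3P[p_pr _ _].
by rewrite p_part pfactor_dvdn // (logn_degree_le irr_chi irr_psi).
Qed.

Theorem corollaryS3 (n : nat) (chi psi : 'CF([set: 'S_n]))
    (irr_chi : chi \in irr [set: 'S_n]) (irr_psi : psi \in irr [set: 'S_n]) :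
  (Van_pow chi \subset Van_pow psi -> chi 1%g <= psi 1%g)
  /\ (Van_pow chi = Van_pow psi -> chi 1%g = psi 1%g).
Proof.
split=> [|vanE]; first exact: irr1_le_Van_pow.
by apply: le_anti; rewrite !irr1_le_Van_pow // vanE.
Qed.
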